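(* In the setting described in the context (rooted tree network, simplified AC power flow model), assume that the ratio $r_{pk}/x_{pk}$ is the same for all edges $\epsilon_{pk}\in\mathcal E$. For $\boldsymbol z\in(0,\infty)^{I\times J}$ let $\boldsymbol\Lambda(\boldsymbol z)$ be the unique optimal solution (the $\boldsymbol\Lambda$-component) of the problem of maximizing $\sum_{i=1}^I\sum_{j=1}^Jz_{ij}u_{ij}(\Lambda_{ij}/z_{ij})$ over all $\boldsymbol\Lambda$ that are feasible for $\boldsymbol z$. Then $\boldsymbol z\mapsto\boldsymbol\Lambda(\boldsymbol z)$ is a continuous function on $(0,\infty)^{I\times J}$.
   Context: Network. $(\mathcal I,\mathcal E)$ is a rooted tree with nodes $\mathcal I=\{0,1,\dots,I\}$ and root $0$. An edge $\epsilon_{pk}\in\mathcal E$ joins a node $p$ to its child $k$ and has resistance $r_{pk}>0$ and reactance $x_{pk}>0$. For a node $k$, $\mathcal I(k)$ and $\mathcal E(k)$ are the node and edge sets of the subtree rooted at $k$ (including $k$). There are $J$ vehicle types. Constants: $M_i>0$ ($i\ge1$), $c^{\max}_j>0$, $W_{00}>0$ given, and voltage bounds $0<\underline\upsilon_k\le W_{00}\le\overline\upsilon_k$ for $k\ge1$. The functions $u_{ij}$ are strictly increasing and concave on $\mathbb R_+$, twice differentiable on $(0,\infty)$, with $\lim_{x\to0}u'_{ij}(x)=\infty$ (the value $-\infty$ at $0$ is allowed, e.g. $u_{ij}(x)=w_{ij}\log x$). Feasibility. For $\boldsymbol z\in[0,\infty)^{I\times J}$, a vector $\boldsymbol\Lambda=(\Lambda_{ij})_{1\le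 i\le I,1\le j\le J}$ is feasible for $\boldsymbol z$ if $$\sum_{j=1}^J\Lambda_{ij}\le M_i,\qquad 0\le\Lambda_{ij}\le z_{ij}c_j^{\max}\qquad\text{for all }i,j,$$ and there exist real numbers $W_{kk}$ ($k\ge1$) and $W_{pk}=W_{kp}$ ($\epsilon_{pk}\in\mathcal E$) such that for every $\epsilon_{pk}\in\mathcal E$ $$W_{pk}-W_{kk}-P_{\mathcal I(k)}r_{pk}-Q_{\mathcal I(k)}x_{pk}=0,\qquad\underline\upsilon_k\le W_{kk}\le\overline\upsilon_k,\qquad\begin{pmatrix} W_{pp} & W_{pk} \\ W_{kp} & W_{kk} \end{pmatrix}\succeq0,$$ where $$P_{\mathcal I(k)}=\sum_{l\in\mathcal I(k)}\sum_{j=1}^J\Lambda_{lj}+\sum_{\epsilon_{ls}\in\mathcal E(k)}\frac{(W_{ll}-2W_{ls}+W_{ss})\,r_{ls}}{r_{ls}^2+x_{ls}^2},\qquad Q_{\mathcal I(k)}=\sum_{\epsilon_{ls}\in\mathcal E(k)}\frac{(W_{ll}-2W_{ls}+W_{ss})\,x_{ls}}{r_{ls}^2+x_{ls}^2}.$$ *)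

(* Defs.v *)
From HB Require Import structures.
From mathcomp Require Import all_boot all_order all_algebra.
From mathcomp Require Import all_classical all_reals all_analysis.
Set Implicit Arguments.
Unset Strict Implicit.
Unset Printing Implicit Defensive.
Import Order.TTheory GRing.Theory Num.Theory.
Import numFieldNormedType.Exports.
Local Open Scope classical_set_scope.
Local Open Scope ring_scope.

(* [E p k] means that p is the parent of k. *)
Definition rooted_tree (T : finType) (E : rel T) (root : T) : Prop :=
  [/\ forall p, ~~ E p root,
      forall k, k != root -> exists! p, E p k
    & forall k, connect E root k].

Definition subtree_nodes (T : finType) (E : rel T) (k : T) : {set T} :=
  [set l | connect E k l].

Definition subtree_edges (T : finType) (E : rel T) (k : T) : {set T * T} :=
  [set e | [&& E e.1 e.2, e.1 \in subtree_nodes E k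
             & e.2 \in subtree_nodes E k]].

Definition psd (R : realType) (d : nat) (A : 'M[R]_d) : Prop :=
  A^T = A /\ forall v : 'rV[R]_d, 0 <= (v *m A *m v^T) 0 0.

Definition mx2 (R : realType) (a b c d : R) : 'M[R]_(1 + 1) :=
  block_mx a%:M b%:M c%:M d%:M.

(* The nodes are 'I_n.+1, the root is ord0 and the other nodes are
   [bus i] for i : 'I_n.  The values of [resist] and [react] outside the edges,
   and of [cap], [vlo] and [vhi] at the root, are irrelevant. *)
Record network (R : realType) (n J : nat) := Network {
  edge : rel 'I_n.+1;
  resist : 'I_n.+1 -> 'I_n.+1 -> R;
  react : 'I_n.+1 -> 'I_n.+1 -> R;
  cap : 'I_n.+1 -> R;
  cmax : 'I_J -> R;
  W00 : R;
  vlo : 'I_n.+1 -> R;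
  vhi : 'I_n.+1 -> R;
  edge_tree : rooted_tree edge ord0;
  resist_gt0 : forall p k, edge p k -> 0 < resist p k;
  react_gt0 : forall p k, edge p k -> 0 < react p k;
  cap_gt0 : forall k, k != ord0 -> 0 < cap k;
  cmax_gt0 : forall j, 0 < cmax j;
  W00_gt0 : 0 < W00;
  vlo_gt0 : forall k, k != ord0 -> 0 < vlo k;
  vlo_le_W00 : forall k, k != ord0 -> vlo k <= W00;
  W00_le_vhi : forall k, k != ord0 -> W00 <= vhi k
}.

Definition bus (n : nat) (i : 'I_n) : 'I_n.+1 := lift ord0 i.

Section PowerFlow.
Context (R : realType) (n J : nat) (N : network R n J).
Implicit Types (W : 'M[R]_n.+1) (L z : 'M[R]_(n, J)).

Definition P_subtree W L (k : 'I_n.+1) : R :=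
  \sum_(i < n | bus i \in subtree_nodes (edge N) k) \sum_(j < J) L i j
  + \sum_(e in subtree_edges (edge N) k)
      (W e.1 e.1 - 2 * W e.1 e.2 + W e.2 e.2) * resist N e.1 e.2
      / (resist N e.1 e.2 ^+ 2 + react N e.1 e.2 ^+ 2).

Definition Q_subtree W (k : 'I_n.+1) : R :=
  \sum_(e in subtree_edges (edge N) k)
      (W e.1 e.1 - 2 * W e.1 e.2 + W e.2 e.2) * react N e.1 e.2
      / (resist N e.1 e.2 ^+ 2 + react N e.1 e.2 ^+ 2).

(* Only the diagonal entries of W and those indexed by edges are constrained;
   the other entries are junk. *)
Definition power_flow W L : Prop :=
  W ord0 ord0 = W00 N /\
  forall p k, edge N p k ->
    [/\ W p k = W k p,
        W p k - W k k - P_subtree W L k * resist N p k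
          - Q_subtree W k * react N p k = 0,
        vlo N k <= W k k <= vhi N k
      & psd (mx2 (W p p) (W p k) (W k p) (W k k))].

Definition feasible z L : Prop :=
  [/\ forall i, \sum_(j < J) L i j <= cap N (bus i),
      forall i j, 0 <= L i j <= z i j * cmax N j
    & exists W, power_flow W L].

Definition objective (u : 'I_n -> 'I_J -> R -> \bar R) z L : \bar R :=
  (\sum_(i < n) \sum_(j < J) (z i j)%:E * u i j (L i j / z i j)%R)%E.

Definition optimal (u : 'I_n -> 'I_J -> R -> \bar R) z L : Prop :=
  feasible z L /\
  forall L', feasible z L' -> (objective u z L' <= objective u z L)%E.

End PowerFlow.

Definition same_ratio (R : realType) (n J : nat) (N : network R n J) : Prop :=
  forall p k p' k', edge N p k -> edge N p' k' ->
    resist N p k / react N p k = resist N p' k' / react N p' k'.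

Definition pos_mx (R : realType) (n J : nat) : set 'M[R]_(n, J) :=
  [set z : 'M[R]_(n, J) | forall i j, 0 < z i j].

(* Functions on [0, +oo[ with values in [-oo, +oo[; the values at negative
   arguments are irrelevant.  In \bar R one has 0 * -oo = 0, so t = 0 and
   t = 1 are harmless below. *)
Definition concave_on_nneg (R : realType) (u : R -> \bar R) : Prop :=
  forall x y t : R, 0 <= x -> 0 <= y -> 0 <= t <= 1 ->
    (t%:E * u x + (1 - t)%:E * u y <= u (t * x + (1 - t) * y)%R)%E.

Definition strictly_concave_on_nneg (R : realType) (u : R -> \bar R) : Prop :=
  forall x y t : R, 0 <= x -> 0 <= y -> x != y -> 0 < t < 1 ->
    (t%:E * u x + (1 - t)%:E * u y < u (t * x + (1 - t) * y)%R)%E.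

Record utility (R : realType) (u : R -> \bar R) : Prop := Utility {
  utility_fin : forall x : R, 0 < x -> u x \is a fin_num;
  utility_incr : forall x y : R, 0 <= x -> x < y -> (u x < u y)%E;
  utility_concave : concave_on_nneg u;
  utility_derivable : forall x : R, 0 < x -> derivable (fine \o u) x 1;
  utility_derivable2 : forall x : R, 0 < x -> derivable (derive1 (fine \o u)) x 1;
  utility_deriv0 : derive1 (fine \o u) x @[x --> (0 : R)^'+] --> +oo
}.

(* Main.v *)
(** The loads satisfying the capacity bounds for which the power flow
    equations are solvable form a compact convex set containing 0: the
    equations are linear in (W, L) and positive semidefiniteness is a convex
    condition. Since the only other constraint is [L i j <= z i j * cmax j],
    whether some feasible load is positive at (i, j) does not depend on z;
    call (i, j) active if so. Moving a load a little towards one that is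
    positive at all active coordinates improves it if one of its active
    coordinates is too small, because the marginal utilities are infinite at
    0. So optima can be sought, uniformly for z in a compact set, among the
    loads whose active coordinates are at least some d > 0, where the
    objective is finite and jointly continuous even if utilities jump to a
    lower value or to -oo at 0. Existence follows by compactness, and
    continuity by Berge's maximum theorem: if L is feasible at z0 and
    s < 1, then s L is feasible at all z near z0. *)
Require Import Defs.
From mathcomp Require Import all_boot all_order all_algebra.
From mathcomp Require Import all_classical all_reals all_analysis.
From mathcomp Require Import ring lra.
Set Implicit Arguments.
Unset Strict Implicit.
Unset Printing Implicit Defensive.
Import Order.TTheory GRing.Theory Num.Theory.
Import numFieldNormedType.Exports.
Local Open Scope classical_set_scope.
Local Open Scope ring_scope.

(** * Matrix topology, closed conditions and 2 by 2 semidefiniteness *)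

Lemma continuous_mx (R : realType) (T : topologicalType) (m n : nat)
    (f : T -> 'M[R]_(m, n)) :
  (forall i j, continuous (fun x => f x i j)) -> continuous f.
Proof.
move=> fc x A [P Px sPA]; apply: filterS => [y|]; first exact: sPA.
by do 2 (apply: filter_forall => ?); apply: fc; apply: Px.
Qed.

(** The box is the image under the continuous map [vec_mx] of a product of segments of row vectors,
    compact by Tychonoff. *)
Lemma compact_mx_box (R : realType) (m n : nat) (a b : R) :
  compact [set A : 'M[R]_(m, n) | forall i j, a <= A i j <= b].
Proof.
have -> : [set A : 'M[R]_(m, n) | forall i j, a <= A i j <= b] =
    vec_mx @` [set v : 'rV[R]_(m * n) | forall k, `[a, b]%classic (v ord0 k)].
  apply/seteqP; split=> [A Aab|_ [v vab <-] i j]; last first.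
    by rewrite mxE; have := vab (mxvec_index i j); rewrite /= in_itv.
  exists (mxvec A); last exact: mxvecK.
  by case/mxvec_indexP => i j; rewrite mxvecE /= in_itv /= Aab.
apply: continuous_compact.
  apply: continuous_subspaceT; apply: continuous_mx => i j.
  rewrite [X in continuous X](_ : _ =
    fun v : 'rV[R]_(m * n) => v ord0 (mxvec_index i j)).
    exact: coord_continuous.
  by apply/funext => v; rewrite mxE.
apply: (@rV_compact R _ (fun=> `[a, b]%classic)) => k; exact: segment_compact.
Qed.

Lemma closed_preimage_ge0 (R : realType) (T : topologicalType) (f : T -> R) :
  continuous f -> closed [set x | 0 <= f x].
Proof.
by move=> fc; apply: (closed_comp _ (@closed_ge R 0)) => x _; exact: fc.
Qed.

Lemma closed_preimage_eq0 (R : realType) (T : topologicalType) (f : T -> R) :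
  continuous f -> closed [set x | f x = 0].
Proof.
by move=> fc; apply: (closed_comp _ (@closed_eq R 0)) => x _; exact: fc.
Qed.

(** Semidefiniteness becomes a family of inequalities, each linear in the entries, so that it
    visibly passes to convex combinations and limits. *)
Lemma psd_mx2P (R : realType) (a b c d : R) :
  psd (mx2 a b c d) <->
  b = c /\ forall x y, 0 <= x * x * a + x * y * b + y * x * c + y * y * d.
Proof.
have quad x y : (row_mx x%:M y%:M *m mx2 a b c d *m (row_mx x%:M y%:M)^T) 0 0 =
    x * x * a + x * y * b + y * x * c + y * y * d :> R.
  rewrite /mx2 mul_row_block tr_row_mx mul_row_col !tr_scalar_mx -!scalar_mxM.
  rewrite -!raddfD /= -!scalar_mxM -raddfD /= mxE eqxx mulr1n; ring.
split=> [[sym pos]|[bc pos]].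
  split; last by move=> x y; rewrite -quad; exact: pos.
  move: sym; rewrite /mx2 tr_block_mx !tr_scalar_mx => /eq_block_mx[_ + _ _].
  by move=> /matrixP /(_ 0 0); rewrite !mxE.
split; first by rewrite /mx2 tr_block_mx !tr_scalar_mx bc.
move=> v; have -> : v = row_mx (lsubmx v 0 0)%:M (rsubmx v 0 0)%:M.
  by rewrite -!mx11_scalar hsubmxK.
by rewrite quad; exact: pos.
Qed.

Lemma continuous_coord (R : realType) (m n : nat) (i : 'I_m) (j : 'I_n) :
  continuous (fun A : 'M[R]_(m, n) => A i j).
Proof. exact: coord_continuous. Qed.

Lemma cvg_mx_coord (R : realType) (T : Type) (F : set_system T)
    (FF : Filter F) (m k : nat) (f : T -> 'M[R]_(m, k)) (A : 'M[R]_(m, k)) i j :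
  f @ F --> A -> f x i j @[x --> F] --> A i j.
Proof.
move=> fA.
apply: (@cvg_comp _ _ _ f (fun M : 'M[R]_(m, k) => M i j) _ (nbhs A)) => //.
exact: coord_continuous.
Qed.

Lemma continuous_affine (R : realType) (T : topologicalType) (f : T -> R)
    (r s : R) :
  continuous f -> continuous (fun x => r + s * f x).
Proof.
move=> cf x; apply: cvgD; first exact: cvg_cst.
by apply: cvgM; [exact: cvg_cst|exact: cf].
Qed.

Lemma closed_forall (T : topologicalType) (I : Type) (P : I -> set T) :
  (forall i, closed (P i)) -> closed [set x | forall i, P i x].
Proof.
move=> clP; rewrite (_ : mkset _ = \bigcap_(i in setT) P i).
  by apply: closed_bigI => i _; exact: clP.
by apply/seteqP; split=> x Px i => [_|]; exact: Px.
Qed.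

(** * The set of admissible loads *)

Section Loads.
Context (R : realType) (n J : nat) (N : network R n J).

Definition loads := [set L : 'M[R]_(n, J) |
  [/\ forall i, \sum_(j < J) L i j <= cap N (bus i),
      forall i j, 0 <= L i j
    & exists W, power_flow N W L]].

Lemma feasibleP z L :
  feasible N z L <-> loads L /\ forall i j, L i j <= z i j * cmax N j.
Proof.
split=> [[capL boxL pfL]|[[capL posL pfL] ubL]].
  by split=> [|i j]; [split=> // i j|]; case/andP: (boxL i j).
by split=> // i j; rewrite posL ubL.
Qed.

Definition edge_eq (W : 'M[R]_n.+1) (L : 'M[R]_(n, J)) (p k : 'I_n.+1) : R :=
  W p k - W k k - P_subtree N W L k * resist N p k
    - Q_subtree N W k * react N p k.

Definition edge_psd (W : 'M[R]_n.+1) (p k : 'I_n.+1) (x y : R) : R :=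
  x * x * W p p + x * y * W p k + y * x * W k p + y * y * W k k.

(** Every constraint takes the form [_ = 0] or [0 <= _] with an expression affine in [(W, L)];
    convexity and closedness are both read off this form. *)
Lemma power_flowP W L :
  power_flow N W L <->
  W ord0 ord0 - W00 N = 0 /\
  forall p k, edge N p k ->
    [/\ W p k - W k p = 0, edge_eq W L p k = 0,
        0 <= W k k - vlo N k /\ 0 <= vhi N k - W k k
      & forall x y, 0 <= edge_psd W p k x y].
Proof.
split=> [[W0 WE]|[W0 WE]]; split.
- by rewrite W0 subrr.
- move=> p k /WE [sym eqn /andP[lo hi] /psd_mx2P[_ pos]].
  split; [by rewrite sym subrr|exact: eqn| |exact: pos].
  by rewrite !subr_ge0 lo hi.
- by apply/eqP; rewrite -subr_eq0 W0.
- move=> p k /WE [/eqP + eqn [lo hi] pos]; rewrite subr_eq0 => /eqP sym.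
  split; [exact: sym|exact: eqn| |].
    by rewrite -subr_ge0 lo -subr_ge0 hi.
  apply/psd_mx2P; split; [exact: sym|exact: pos].
Qed.

Lemma P_subtree_comb s t W W' L L' k :
  P_subtree N (s *: W + t *: W') (s *: L + t *: L') k =
  s * P_subtree N W L k + t * P_subtree N W' L' k.
Proof.
rewrite /P_subtree !mulrDr addrACA !mulr_sumr -!big_split /=.
congr (_ + _); apply: eq_bigr => i _; last by rewrite !mxE; ring.
rewrite !mulr_sumr -big_split /=; apply: eq_bigr => j _.
by rewrite !mxE.
Qed.

Lemma Q_subtree_comb s t W W' k :
  Q_subtree N (s *: W + t *: W') k =
  s * Q_subtree N W k + t * Q_subtree N W' k.
Proof.
rewrite /Q_subtree !mulr_sumr -big_split /=.
by apply: eq_bigr => i _; rewrite !mxE; ring.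
Qed.

(** By affinity, each residual at the combination is the same combination of the two residuals. *)
Lemma power_flow_comb t W W' L L' : 0 <= t <= 1 ->
  power_flow N W L -> power_flow N W' L' ->
  power_flow N ((1 - t) *: W + t *: W') ((1 - t) *: L + t *: L').
Proof.
move=> /andP[t0 t1] /power_flowP[W0 WE] /power_flowP[W0' WE'].
apply/power_flowP.
have s0 : 0 <= 1 - t by rewrite subr_ge0.
split=> [|p k pk].
  rewrite !mxE (_ : _ - _ = (1 - t) * (W ord0 ord0 - W00 N)
    + t * (W' ord0 ord0 - W00 N)); last by ring.
  by rewrite W0 W0' !mulr0 addr0.
have [sym eqn [lo hi] pos] := WE p k pk.
have [sym' eqn' [lo' hi'] pos'] := WE' p k pk.
have comb0 a b : 0 <= a -> 0 <= b -> 0 <= (1 - t) * a + t * b.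
  by move=> a0 b0; rewrite addr_ge0 // mulr_ge0.
split.
- rewrite !mxE (_ : _ - _ = (1 - t) * (W p k - W k p)
    + t * (W' p k - W' k p)); last by ring.
  by rewrite sym sym' !mulr0 addr0.
- rewrite /edge_eq P_subtree_comb Q_subtree_comb !mxE.
  rewrite (_ : _ - _ = (1 - t) * edge_eq W L p k + t * edge_eq W' L' p k).
    by rewrite eqn eqn' !mulr0 addr0.
  by rewrite /edge_eq; ring.
- rewrite !mxE; have H1 := comb0 _ _ lo lo'; have H2 := comb0 _ _ hi hi'.
  by split; [move: H1|move: H2]; congr (_ <= _); ring.
- move=> x y; have := comb0 _ _ (pos x y) (pos' x y).
  by rewrite /edge_psd !mxE; congr (_ <= _); ring.
Qed.

Lemma loads_comb t L L' : 0 <= t <= 1 -> loads L -> loads L' ->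
  loads ((1 - t) *: L + t *: L').
Proof.
move=> t01 [capL posL [W WL]] [capL' posL' [W' WL']].
have /andP[t0 t1] := t01; have s0 : 0 <= 1 - t by rewrite subr_ge0.
split=> [i|i j|].
- under eq_bigr do rewrite !mxE.
  rewrite big_split /= -!mulr_sumr.
  rewrite [leRHS](_ : _ = (1 - t) * cap N (bus i) + t * cap N (bus i));
    last by ring.
  by rewrite lerD // ler_wpM2l.
- by rewrite !mxE addr_ge0 // mulr_ge0.
- by exists ((1 - t) *: W + t *: W'); exact: power_flow_comb.
Qed.

(** With no load, the constant voltage [W00] works: nothing flows, the voltage bounds enclose [W00],
    and the quadratic form of each edge is [(x + y) ^+ 2 * W00]. *)
Lemma loads0 : loads 0.
Proof.
split=> [i|i j|]; rewrite ?mxE //.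
  by rewrite big1 ?ltW ?cap_gt0 // => j _; rewrite mxE.
exists (const_mx (W00 N)); apply/power_flowP; rewrite mxE subrr.
split=> // p k pk.
have k0 : k != ord0.
  by apply: contraTneq pk => ->; case: (edge_tree N).
have P0 : P_subtree N (const_mx (W00 N)) 0 k = 0.
  rewrite /P_subtree !big1 ?addr0 // => [e _|i _]; first by rewrite !mxE; ring.
  by rewrite big1 // => j _; rewrite mxE.
have Q0 : Q_subtree N (const_mx (W00 N)) k = 0.
  by rewrite /Q_subtree big1 // => e _; rewrite !mxE; ring.
rewrite /edge_eq P0 Q0 !mxE; split.
- by rewrite subrr.
- by ring.
- by rewrite !subr_ge0 vlo_le_W00 ?W00_le_vhi.
- move=> x y; rewrite /edge_psd !mxE.
  rewrite (_ : _ + _ = (x + y) ^+ 2 * W00 N); last by ring.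
  by rewrite mulr_ge0 ?sqr_ge0 // ltW ?W00_gt0.
Qed.

End Loads.

(** * Compactness of the set of loads *)

Section LoadsCompact.
Context (R : realType) (n J : nat) (N : network R n J).

Local Notation state := ('M[R]_(n, J) * 'M[R]_n.+1)%type.

Let adjacent (p k : 'I_n.+1) := [|| p == k, edge N p k | edge N k p].

(* Only the entries of W on the diagonal and along edges are constrained, so
   the other ones may be set to 0 to get a bounded set of voltage matrices. *)
Definition edge_part (W : 'M[R]_n.+1) : 'M[R]_n.+1 :=
  \matrix_(p, k) if adjacent p k then W p k else 0.

Lemma edge_partE W p k : adjacent p k -> edge_part W p k = W p k.
Proof. by move=> pk; rewrite mxE pk. Qed.

Lemma power_flow_edge_part W L :
  power_flow N W L -> power_flow N (edge_part W) L.
Proof.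
have adjd p : adjacent p p by rewrite /adjacent eqxx.
have adje p k : edge N p k -> adjacent p k.
  by rewrite /adjacent => ->; rewrite orbT.
have adje' p k : edge N p k -> adjacent k p.
  by rewrite /adjacent => ->; rewrite !orbT.
have PE k : P_subtree N (edge_part W) L k = P_subtree N W L k.
  congr (_ + _); apply: eq_bigr => e; rewrite inE => /and3P[eE _ _].
  by rewrite !(edge_partE _ (adjd _)) (edge_partE _ (adje _ _ eE)).
have QE k : Q_subtree N (edge_part W) k = Q_subtree N W k.
  rewrite /Q_subtree; apply: eq_bigr => e; rewrite inE => /and3P[eE _ _].
  by rewrite !(edge_partE _ (adjd _)) (edge_partE _ (adje _ _ eE)).
move=> [W0 WE]; split=> [|p k pk]; first by rewrite edge_partE.
rewrite PE QE !(edge_partE _ (adjd _)) (edge_partE _ (adje _ _ pk)).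
by rewrite (edge_partE _ (adje' _ _ pk)); exact: WE.
Qed.

Let voltage_bound := W00 N + \sum_k `|vhi N k|.

Lemma power_flow_diag W L k :
  power_flow N W L -> 0 <= W k k <= voltage_bound.
Proof.
have sum_ge0 : 0 <= \sum_k `|vhi N k| by rewrite sumr_ge0.
have W00_ge0 : 0 <= W00 N by rewrite ltW ?W00_gt0.
move=> [W0 WE]; have [->|k0] := eqVneq k ord0.
  by rewrite W0 W00_ge0 lerDl.
case: (edge_tree N) => _ /(_ k k0) [p [pk _]] _.
have [_ _ /andP[lo hi] _] := WE p k pk.
rewrite (le_trans (ltW (vlo_gt0 N k0)) lo) /=.
rewrite (le_trans hi) // (le_trans (ler_norm _)) // /voltage_bound.
rewrite (bigD1 k) //=.
by rewrite addrCA lerDl addr_ge0 ?sumr_ge0.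
Qed.

Lemma power_flow_edge W L p k : power_flow N W L -> edge N p k ->
  - voltage_bound <= W p k <= voltage_bound.
Proof.
move=> WL pk; have /andP[_ pp] := power_flow_diag p WL.
have /andP[_ kk] := power_flow_diag k WL.
have [_ /(_ _ _ pk) [/eqP + _ _ pos]] := (power_flowP N W L).1 WL.
rewrite subr_eq0 => /eqP sym.
(* The quadratic form at [(1, 1)] and [(1, -1)] gives [2 * |W p k| <= W p p + W k k]. *)
have := pos 1 1; have := pos 1 (-1); rewrite /edge_psd -sym => P1 P2.
by apply/andP; split; lra.
Qed.

Lemma edge_part_bound W L p k : power_flow N W L ->
  - voltage_bound <= edge_part W p k <= voltage_bound.
Proof.
move=> WL; have B0 : 0 <= voltage_bound.
  by have /andP[] := power_flow_diag p WL; exact: le_trans.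
rewrite mxE; case: ifP => [|_]; last by rewrite oppr_le0 B0.
case/or3P => [/eqP <-|pk|kp].
- have /andP[W0 WB] := power_flow_diag p WL.
  by rewrite WB (le_trans _ W0) // oppr_le0.
- exact: power_flow_edge WL pk.
- have [_ /(_ _ _ kp) [sym _ _ _]] := WL.
  rewrite -sym; exact: power_flow_edge WL kp.
Qed.

Let load_bound := \sum_k `|cap N k|.

Lemma loads_bound L i j : loads N L -> 0 <= L i j <= load_bound.
Proof.
move=> [capL posL _]; rewrite posL /=.
apply: (@le_trans _ _ (\sum_j L i j)).
  by rewrite (bigD1 j) //= lerDl sumr_ge0.
apply: (le_trans (capL i)); apply: (le_trans (ler_norm _)).
by rewrite /load_bound (bigD1 (bus i)) //= lerDl sumr_ge0.
Qed.

Let solutions :=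
  [set q : state | [/\ forall i, \sum_(j < J) q.1 i j <= cap N (bus i),
                       forall i j, 0 <= q.1 i j
                     & power_flow N q.2 q.1]].

Lemma closed_solutions : closed solutions.
Proof.
have cL i j : continuous (fun q : state => q.1 i j).
  move=> q.
  apply: (@cvg_comp _ _ _ fst (fun L : 'M[R]_(n, J) => L i j) _ (nbhs q.1)).
    exact: cvg_fst.
  exact: coord_continuous.
have cW p k : continuous (fun q : state => q.2 p k).
  move=> q.
  apply: (@cvg_comp _ _ _ snd (fun W : 'M[R]_n.+1 => W p k) _ (nbhs q.2)).
    exact: cvg_snd.
  exact: coord_continuous.
have cst (c : R) : continuous (fun q : state => c).
  by move=> q; exact: cvg_cst.
have cD (f g : state -> R) : continuous f -> continuous g ->
    continuous (fun q => f q + g q).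
  by move=> cf cg q; apply: cvgD; [exact: cf|exact: cg].
have cB (f g : state -> R) : continuous f -> continuous g ->
    continuous (fun q => f q - g q).
  by move=> cf cg q; apply: cvgB; [exact: cf|exact: cg].
have cM (f g : state -> R) : continuous f -> continuous g ->
    continuous (fun q => f q * g q).
  by move=> cf cg q; apply: cvgM; [exact: cf|exact: cg].
have csum (I : Type) (r : seq I) (P : pred I)
    (f : I -> state -> R) :
    (forall i, continuous (f i)) ->
    continuous (fun q => \sum_(i <- r | P i) f i q).
  by move=> cf q; apply: cvg_big => [|i _]; [exact: add_continuous|exact: cf].
have cP k : continuous (fun q => P_subtree N q.2 q.1 k).
  rewrite /P_subtree; apply: (cD); apply: (csum) => i.
    by apply: (csum) => j; exact: (cL).
  do 2 (apply: (cM); last exact: (cst)); apply: (cD) => //.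
  by apply: (cB) => //; exact: (cM).
have cQ k : continuous (fun q : state => Q_subtree N q.2 k).
  rewrite /Q_subtree; apply: (csum) => i.
  do 2 (apply: (cM); last exact: (cst)); apply: (cD) => //.
  by apply: (cB) => //; exact: (cM).
(* The edge hypothesis is quantified as a proof [pk], so that [closed_forall] treats it as one more
   index. *)
rewrite (_ : solutions =
    [set q : state | forall i, 0 <= cap N (bus i) - \sum_(j < J) q.1 i j]
    `&` [set q : state | forall i j, 0 <= q.1 i j]
    `&` ([set q : state | q.2 ord0 ord0 - W00 N = 0]
    `&` [set q : state | forall p k, forall pk : edge N p k,
      ([set q : state | q.2 p k - q.2 k p = 0]
      `&` [set q : state | edge_eq N q.2 q.1 p k = 0]
      `&` ([set q : state | 0 <= q.2 k k - vlo N k]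
        `&` [set q : state | 0 <= vhi N k - q.2 k k])
      `&` [set q : state | forall x y, 0 <= edge_psd q.2 p k x y]) q])).
  apply: closedI; [apply: closedI|apply: closedI].
  - apply: closed_forall => i; apply: closed_preimage_ge0.
    by apply: (cB) => //; apply: (csum).
  - by do 2 (apply: closed_forall => ?); apply: closed_preimage_ge0.
  - by apply: closed_preimage_eq0; exact: (cB).
  - do 3 (apply: closed_forall => ?).
    apply: closedI; first (apply: closedI; apply: closedI).
    + by apply: closed_preimage_eq0; exact: (cB).
    + apply: closed_preimage_eq0; rewrite /edge_eq.
      by apply: (cB); [apply: (cB); [exact: (cB)|exact: (cM)]|exact: (cM)].
    + by apply: closed_preimage_ge0; exact: (cB).
    + by apply: closed_preimage_ge0; exact: (cB).
    + do 2 (apply: closed_forall => ?); apply: closed_preimage_ge0.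
      by rewrite /edge_psd; do 3?[apply: (cD)]; apply: (cM).
apply/seteqP; split=> q.
  move=> [capq posq /power_flowP[W0 WE]].
  split; first by split=> // i; rewrite subr_ge0; exact: capq.
  split; first exact: W0.
  by move=> p k pk; have [sym eqn lohi pos] := WE p k pk;
    split=> [|x y]; [split; [split|]|].
move=> [[capq posq] [W0 WE]]; split=> //.
  by move=> i; rewrite -subr_ge0; exact: capq.
apply/power_flowP; split; first exact: W0.
by move=> p k pk; have [[[sym eqn] lohi] pos] := WE p k pk.
Qed.

(** A projection of a closed set need not be closed. The solutions are first cut down to a compact
    box, which loses no load because [edge_part] turns any voltage matrix into one in the box. *)
Lemma compact_loads : compact (loads N).
Proof.
have := compact_setX (@compact_mx_box R n J 0 load_bound)
  (@compact_mx_box R n.+1 n.+1 (- voltage_bound) voltage_bound).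
set box := (X in compact X) => cbox.
rewrite (_ : loads N = fst @` (box `&` solutions)).
  apply: continuous_compact.
    by apply: continuous_subspaceT => q; exact: cvg_fst.
  exact: (compact_closedI cbox closed_solutions).
apply/seteqP; split=> [L lL|_ [[L W] [_ [/= capL posL WL]] <-]]; last first.
  by split=> //; exists W.
have [capL posL [W WL]] := lL; exists (L, edge_part W) => //.
split; first split=> /= *; first exact: loads_bound.
  exact: edge_part_bound WL.
by split=> //; exact: power_flow_edge_part.
Qed.

End LoadsCompact.

(** * Utility functions *)

Section Utility.
Context (R : realType) (u : R -> \bar R) (u_utility : utility u).

Lemma utility_lty x : 0 <= x -> (u x < +oo)%E.
Proof.
move=> x0; apply: (@lt_le_trans _ _ (u (x + 1))); last exact: leey.
by apply: utility_incr => //; rewrite ltrDl.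
Qed.

Lemma utility_le x y : 0 <= x -> x <= y -> (u x <= u y)%E.
Proof.
by move=> x0; rewrite le_eqVlt => /predU1P[->//|xy]; apply/ltW/utility_incr.
Qed.

Lemma utility_fin_num x : 0 <= x -> (-oo < u x)%E -> u x \is a fin_num.
Proof. by move=> x0 ux; rewrite fin_real // ux utility_lty. Qed.

Lemma utility_continuous x : 0 < x -> {for x, continuous (fine \o u)}.
Proof.
move=> x0; apply: differentiable_continuous; apply/derivable1_diffP.
exact: utility_derivable.
Qed.

(** For [0 < x] this is the mean value theorem, the derivative being at least [2 * M] near 0. *)
Lemma utility_steep (M : R) : 0 <= M -> exists2 e : R, 0 < e &
  forall x y, 0 <= x -> x < y -> y <= e -> (u x + (M * (y - x))%:E <= u y)%E.
Proof.
move=> M0; have /cvgryPge/(_ (2 * M)) := utility_deriv0 u_utility.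
move=> /nbhs_ballP[e /= e0 eM]; exists (e / 2); first exact: divr_gt0.
have slope (x y : R) : 0 < x -> x < y -> y <= e / 2 ->
    (u x + (2 * M * (y - x))%:E <= u y)%E.
  move=> x0 xy ye; have y0 := lt_trans x0 xy.
  rewrite -(fineK (utility_fin u_utility x0)).
  rewrite -(fineK (utility_fin u_utility y0)).
  rewrite -EFinD lee_fin -lerBrDl.
  have [z|z|c] := @MVT R (fine \o u) (derive1 (fine \o u)) x y xy.
  - rewrite in_itv /= => /andP[xz _]; rewrite derive1E; apply: derivableP.
    by apply: utility_derivable => //; exact: lt_trans xz.
  - apply: continuous_in_subspaceT => {}z.
    rewrite inE /= in_itv /= => /andP[xz _].
    by apply: utility_continuous; exact: lt_le_trans xz.
  - rewrite in_itv /= => /andP[xc cy] ->; rewrite ler_pM2r ?subr_gt0 //.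
    apply: eM; last exact: lt_trans xc.
    rewrite /ball /= sub0r normrN gtr0_norm ?(lt_trans x0) //; lra.
move=> x y; rewrite le_eqVlt => /predU1P[<-|x0] xy ye; last first.
  apply: le_trans (slope _ _ x0 xy ye); rewrite leeD2l // lee_fin.
  by rewrite ler_wpM2r ?subr_ge0 ?(ltW xy) //; lra.
(* Case [x = 0], where [u] may jump or be -oo: monotonicity covers the first half of the segment,
   and slope [2 * M] on the second half alone yields [M * y]. *)
have y2 : 0 < y / 2 by rewrite divr_gt0.
have y2y : y / 2 < y by rewrite ltr_pdivrMr // ltr_pMr // ltr1n.
apply: le_trans (slope _ _ y2 y2y ye); apply: leeD.
  exact: utility_le (lexx _) (ltW y2).
by rewrite lee_fin; lra.
Qed.

(** Concavity bounds the loss by [t * (u x - u y)], and monotonicity replaces [x] and [y] by the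
    uniform bounds [b] and [a]. *)
Lemma utility_comb_loss (x y a b t : R) :
  0 <= x <= b -> 0 < a <= y -> 0 <= t <= 1 -> u x \is a fin_num ->
  fine (u x) - t * (fine (u b) - fine (u a)) <= fine (u ((1 - t) * x + t * y)).
Proof.
move=> /andP[x0 xb] /andP[a0 ay] /andP[t0 t1] ux.
have y0 : 0 < y := lt_le_trans a0 ay.
have s01 : 0 <= 1 - t <= 1 by apply/andP; split; lra.
(* Finiteness of [u b] is known for [0 < b]; otherwise [b = 0] forces [x = b]. *)
have b0 : 0 < b \/ x = b.
  move: xb; rewrite le_eqVlt => /predU1P[|xb]; first by right.
  by left; exact: le_lt_trans xb.
have ub : fine (u x) <= fine (u b).
  case: b0 => [b0|<-//].
  by rewrite fine_le ?(utility_fin u_utility b0) ?utility_le.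
have ua : fine (u a) <= fine (u y).
  by rewrite fine_le ?(utility_fin u_utility) ?utility_le // ltW.
have := utility_concave u_utility x0 (ltW y0) s01.
rewrite subKr -(fineK ux) -(fineK (utility_fin u_utility y0)) -!EFinM -EFinD.
have : 0 <= (1 - t) * x + t * y.
  by rewrite addr_ge0 // mulr_ge0 ?subr_ge0 // ltW.
move=> /utility_lty; case: (u _) => [c| |] //= _; rewrite lee_fin.
move: (fine (u x)) (fine (u y)) (fine (u a)) (fine (u b)) ub ua => p q r s *.
nra.
Qed.

End Utility.

(** * Optimal loads *)

(** Finitely many conditions, each true for [a] close to 0 on the right; this also covers an empty
    [P]. *)
Lemma finite_pos_lower (R : realType) (T : finType) (P : pred T) (f : T -> R) :
  (forall t, P t -> 0 < f t) -> exists2 a, 0 < a & forall t, P t -> a <= f t.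
Proof.
move=> f0.
have near_f : \forall a \near 0^'+, forall t, P t -> a <= f t.
  apply: filter_forall => t; have [/f0 ft|] := boolP (P t).
    by apply: filterS (nbhs_right_le ft) => a af _.
  by move=> _; apply: nearW.
have [a [a0 af]] := filter_ex (filterI (nbhs_right_gt (0 : R)) near_f).
by exists a.
Qed.

(** The gain at the single index [t0] pays for the losses at all the others. *)
Lemma ler_sum_gain (R : realType) (T : finType) (f g C : T -> R) (t0 : T) :
  (forall t, 0 <= C t) -> (forall t, f t - C t <= g t) ->
  f t0 + \sum_t C t <= g t0 -> \sum_t f t <= \sum_t g t.
Proof.
move=> C0 loss gain; rewrite (bigD1 t0) //= [leRHS](bigD1 t0) //=.
apply: (@le_trans _ _ (f t0 + \sum_t C t + \sum_(t | t != t0) (f t - C t))).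
  rewrite sumrB (bigD1 t0 (F := C)) //=.
  have := C0 t0; move: (\sum_(_ | _) _) (\sum_(_ | _) _) => X Y; lra.
by apply: lerD => //; apply: ler_sum => t _; exact: loss.
Qed.

Section Optimum.
Context (R : realType) (n J : nat) (N : network R n J).
Context (u : 'I_n -> 'I_J -> R -> \bar R).
Context (u_utility : forall i j, utility (u i j)).
Implicit Types (z L : 'M[R]_(n, J)).

Definition active i j := `[< exists2 L, loads N L & 0 < L i j >].

Lemma inactive0 L i j : loads N L -> ~~ active i j -> L i j = 0.
Proof.
move=> lL /asboolPn ninc; apply/eqP; rewrite eq_le.
have [_ -> _] := lL; rewrite andbT leNgt; apply/negP => Lij.
by apply: ninc; exists L.
Qed.

(** Go through the coordinates one by one, averaging the load found so far with one positive at the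
    next active coordinate. Loads are nonnegative, so positivity already gained survives. *)
Lemma active_load :
  exists2 L, loads N L & forall i j, active i j -> 0 < L i j.
Proof.
suff [L lL Lpos] : exists2 L, loads N L & forall p : 'I_n * 'I_J,
    p \in enum {: 'I_n * 'I_J} -> active p.1 p.2 -> 0 < L p.1 p.2.
  by exists L => // i j; apply: (Lpos (i, j)); rewrite mem_enum.
elim: (enum _) => [|p s [L lL Lpos]].
  by exists 0; [exact: loads0|].
have L0 := fun i j => let: And3 _ posL _ := lL in posL i j.
have [/asboolP[K lK Kp]|np] := boolP (active p.1 p.2); last first.
  exists L => // q; rewrite inE => /predU1P[->|]; last exact: Lpos.
  by rewrite (negbTE np).
have K0 := fun i j => let: And3 _ posK _ := lK in posK i j.
exists ((1 - 2^-1) *: L + 2^-1 *: K).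
  by apply: loads_comb => //; apply/andP; split; lra.
move=> q; rewrite inE !mxE => /predU1P[-> _|qs qact].
  by have := L0 p.1 p.2; lra.
by have := Lpos q qs qact; have := K0 q.1 q.2; lra.
Qed.

Let load_bound := \sum_k `|cap N k|.

(** Scaling down an active load keeps it a load, by convexity with 0. With [m] below all bounds
    [z i j * cmax j], one such load is feasible for a whole range of [z]. *)
Lemma small_active_load m : 0 < m ->
  exists2 L, loads N L /\ (forall i j, L i j <= m) &
  exists2 a, 0 < a & forall i j, active i j -> a <= L i j.
Proof.
move=> m0; have [K lK Kpos] := active_load.
have B0 : 0 <= load_bound by exact: sumr_ge0.
(* Entries of [K] are at most [load_bound], so those of [s *: K] are at most [m]. *)
pose s := m / (m + load_bound).
have mB : 0 < m + load_bound by rewrite ltr_pwDl.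
have s0 : 0 < s by rewrite divr_gt0.
have s1 : s <= 1 by rewrite ler_pdivrMr // mul1r lerDl.
have [a a0 aK] : exists2 a, 0 < a &
    forall p : 'I_n * 'I_J, active p.1 p.2 -> a <= s * K p.1 p.2.
  by apply: finite_pos_lower => p /Kpos Kp; rewrite mulr_gt0.
exists (s *: K); last first.
  by exists a => // i j ij; rewrite !mxE; exact: (aK (i, j)).
split=> [|i j].
  have := @loads_comb _ _ _ N s 0 K; rewrite scaler0 add0r; apply=> //.
    by rewrite s1 ltW.
  exact: loads0.
rewrite mxE; have /andP[K0 KB] := loads_bound i j lK.
rewrite /s mulrAC ler_pdivrMr // ler_pM2l //.
by apply: le_trans KB _; rewrite lerDr ltW.
Qed.

Lemma objective_pair z L : objective u z L =
  (\sum_(p : 'I_n * 'I_J)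
     (z p.1 p.2)%:E * u p.1 p.2 (L p.1 p.2 / z p.1 p.2)%R)%E.
Proof. by rewrite /objective pair_bigA. Qed.

Lemma objective_EFin z L :
  (forall i j, u i j (L i j / z i j) \is a fin_num) ->
  objective u z L = (\sum_(p : 'I_n * 'I_J)
     z p.1 p.2 * fine (u p.1 p.2 (L p.1 p.2 / z p.1 p.2)))%:E.
Proof.
move=> ufin; rewrite objective_pair -sumEFin.
by apply: eq_bigr => p _; rewrite EFinM fineK.
Qed.

(** One term -oo makes the whole sum -oo, and positivity of [z] prevents a weight 0 from hiding
    it. *)
Lemma objective_gtNy z L : pos_mx z -> (forall i j, 0 <= L i j) ->
  (-oo < objective u z L)%E -> forall i j, u i j (L i j / z i j) \is a fin_num.
Proof.
move=> z0 L0 objL i j; apply: utility_fin_num => //.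
  by rewrite divr_ge0 // ltW.
rewrite ltNye; apply/eqP => uNy; move: objL; rewrite ltNye => /eqP; apply.
rewrite objective_pair; apply/esum_eqNyP; exists (i, j); split=> //=.
  by rewrite mem_index_enum.
by rewrite uNy gt0_muleNy // lte_fin.
Qed.

(** * A uniform lower bound on active coordinates *)

(** Maximization at [z] may be confined to loads with active coordinates at least [d]; one [d] will
    serve a whole neighbourhood of [z]. *)
Definition dominated d z : Prop :=
  forall L, feasible N z L -> exists L',
    [/\ feasible N z L', forall i j, active i j -> d <= L' i j
      & (objective u z L <= objective u z L')%E].

(* A feasible load with a small active coordinate is improved by a move of
   fixed length t towards a load that is positive on all active coordinates:
   the small coordinate gains t * M with M as large as we please, because the
   marginal utilities are infinite at 0, and the others lose at most a
   constant times t. *)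
Lemma feasible_dominated zlo zhi : 0 < zlo -> zlo <= zhi ->
  exists2 d, 0 < d &
  forall z, (forall i j, zlo <= z i j <= zhi) -> dominated d z.
Proof.
move=> zlo0 zlohi; have zhi0 : 0 < zhi by exact: lt_le_trans zlohi.
have [c c0 cmin] : exists2 c, 0 < c & forall j, true -> c <= cmax N j.
  by apply: finite_pos_lower => j _; exact: cmax_gt0.
(* The target [K] of the move respects [zlo * c], hence is feasible for every [z] in the range. *)
have [K [lK Km] [a a0 aK]] := small_active_load (mulr_gt0 zlo0 c0).
pose B := load_bound + 1.
have B0 : 0 < B by rewrite ltr_wpDl // sumr_ge0.
(* Loss per unit of [t] from [utility_comb_loss]: the ratios [L / z] stay below [B / zlo], the
   active ratios [K / z] above [a / zhi], and the weight is at most [zhi]. *)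
pose C (p : 'I_n * 'I_J) :=
  zhi * `|fine (u p.1 p.2 (B / zlo)) - fine (u p.1 p.2 (a / zhi))|.
have C0 p : 0 <= C p by rewrite mulr_ge0 // ltW.
(* At the small coordinate [L] is below [t * a <= a / 2] and [K] is at least [a], so the gain is at
   least [t * M * (a / 2)], which is the total loss [t * \sum_p C p]. *)
pose M := 2 * (\sum_p C p) / a.
have M0 : 0 <= M by rewrite !mulr_ge0 ?invr_ge0 ?sumr_ge0 // ltW.
have exe (p : 'I_n * 'I_J) : exists e, 0 < e /\ forall x y, 0 <= x -> x < y ->
    y <= e -> (u p.1 p.2 x + (M * (y - x))%:E <= u p.1 p.2 y)%E.
  by have [e e0 steep] := utility_steep (u_utility p.1 p.2) M0; exists e.
have [e eP] := choice exe.
have aB0 : 0 < (a + B) / zlo by exact: divr_gt0 (addr_gt0 a0 B0) zlo0.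
have [t0 t00 t0e] : exists2 t, 0 < t &
    forall p : 'I_n * 'I_J, true -> t <= e p / ((a + B) / zlo).
  apply: finite_pos_lower => p _.
  by apply: divr_gt0 => //; case: (eP p).
(* The bound [t0] keeps the moved small coordinate, at most [t * (a + B)] before division by [z],
   where the utility is steep; [2^-1] gives [t * a <= a / 2]. *)
pose t := Num.min t0 2^-1.
have tgt0 : 0 < t by rewrite lt_min t00 invr_gt0 ltr0n.
have t2 : t <= 2^-1 by rewrite ge_min lexx orbT.
have t1 : t <= 1 by lra.
have te p : t * (a + B) / zlo <= e p.
  rewrite -mulrA -ler_pdivlMr //.
  by rewrite (le_trans _ (t0e p isT)) // ge_min lexx.
exists (t * a) => [|z zb L fL]; first exact: mulr_gt0.
have z0 i j : 0 < z i j by have /andP[+ _] := zb i j; exact: lt_le_trans.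
have [lL Lz] := (feasibleP N z L).1 fL.
have L0 i j : 0 <= L i j by have /andP[] := loads_bound i j lL.
have LB i j : L i j <= B.
  by have /andP[_ LB] := loads_bound i j lL; rewrite (le_trans LB) // lerDl.
have K0 i j : 0 <= K i j by have /andP[] := loads_bound i j lK.
have [/'forall_implyP big|] := boolP [forall p : 'I_n * 'I_J,
    active p.1 p.2 ==> (t * a <= L p.1 p.2)].
  by exists L; split=> // i j; exact: (big (i, j)).
rewrite negb_forall => /existsP[p0].
rewrite negb_imply -ltNge => /andP[act0 small].
exists ((1 - t) *: L + t *: K); split.
- apply/feasibleP; split.
    by apply: loads_comb => //; rewrite t1 ltW.
  move=> i j; rewrite !mxE.
  have Kz : K i j <= z i j * cmax N j.
    apply: le_trans (Km i j) _.
    apply: (ler_pM (ltW zlo0) (ltW c0) _ (cmin j isT)).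
    by case/andP: (zb i j).
  rewrite [leRHS](_ : _ =
    (1 - t) * (z i j * cmax N j) + t * (z i j * cmax N j)).
    by rewrite lerD // ler_wpM2l // ?subr_ge0 // ltW.
  by ring.
- move=> i j ij; rewrite !mxE.
  by rewrite -[leLHS]add0r lerD ?mulr_ge0 ?subr_ge0 // ler_pM2l // aK.
have [->|objL] := eqVneq (objective u z L) -oo%E; first exact: leNye.
rewrite -ltNye in objL.
have ufin := objective_gtNy z0 L0 objL.
have combE i j : ((1 - t) *: L + t *: K) i j / z i j =
    (1 - t) * (L i j / z i j) + t * (K i j / z i j).
  by rewrite !mxE mulrDl !mulrA.
(* Both loads vanish at inactive coordinates, so the move changes nothing there. *)
have inact i j : ~~ active i j -> ((1 - t) *: L + t *: K) i j = L i j.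
  by move=> ij; rewrite !mxE !inactive0 // !mulr0 addr0.
have cfin i j : u i j (((1 - t) *: L + t *: K) i j / z i j) \is a fin_num.
  have [ij|/inact-> //] := boolP (active i j).
  apply: utility_fin => //; rewrite divr_gt0 // !mxE ltr_wpDl //.
    by rewrite mulr_ge0 // subr_ge0.
  by rewrite mulr_gt0 // (lt_le_trans a0) // aK.
rewrite !objective_EFin // lee_fin.
apply: (@ler_sum_gain _ _ _ _ (fun p => t * C p) p0) => [p|[i j] /=|].
- by rewrite mulr_ge0 // ltW.
- have [ij|/inact->] := boolP (active i j); last first.
    by rewrite gerBl mulr_ge0 // ltW.
  have xb : 0 <= L i j / z i j <= B / zlo.
    have z1 : (z i j)^-1 <= zlo^-1.
      by rewrite lef_pV2 ?posrE //; case/andP: (zb i j).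
    by rewrite divr_ge0 ?(ltW (z0 _ _)) //= ler_pM ?invr_ge0 ?(ltW (z0 _ _)).
  have ay : 0 < a / zhi <= K i j / z i j.
    have z1 : zhi^-1 <= (z i j)^-1.
      by rewrite lef_pV2 ?posrE //; case/andP: (zb i j).
    by rewrite divr_gt0 //= ler_pM ?invr_ge0 ?aK ?(ltW a0) ?(ltW zhi0).
  have t01 : 0 <= t <= 1 by rewrite t1 ltW.
  have := utility_comb_loss (u_utility i j) xb ay t01 (ufin i j).
  rewrite -combE -(ler_pM2l (z0 i j)); apply: le_trans.
  rewrite mulrBr lerD2l lerN2 /C /= mulrCA ler_pM2l //.
  apply: (@le_trans _ _
    (z i j * `|fine (u i j (B / zlo)) - fine (u i j (a / zhi))|)).
    by rewrite ler_pM2l // ler_norm.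
  by rewrite ler_wpM2r //; have /andP[] := zb i j.
case: p0 act0 small => i j /= act0 small.
have LK : ((1 - t) *: L + t *: K) i j - L i j = t * (K i j - L i j).
  by rewrite !mxE; ring.
have aKij := aK i j act0.
have LtK : a / 2 <= K i j - L i j.
  have : t * a <= 2^-1 * a by rewrite ler_pM2r.
  lra.
have x0 : 0 <= L i j / z i j by rewrite divr_ge0 // ltW.
have xy : L i j / z i j < ((1 - t) *: L + t *: K) i j / z i j.
  rewrite ltr_pM2r ?invr_gt0 // -subr_gt0 LK mulr_gt0 // (lt_le_trans _ LtK) //.
  exact: divr_gt0.
have ye : ((1 - t) *: L + t *: K) i j / z i j <= e (i, j).
  have zloz : zlo <= z i j by have /andP[] := zb i j.
  apply: le_trans (te (i, j)).
  apply: ler_pM.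
  - rewrite (le_trans (L0 i j)) // -subr_ge0 LK mulr_ge0 ?ltW //.
    by rewrite (lt_le_trans _ LtK) // divr_gt0.
  - by rewrite invr_ge0 ltW.
  - have H1 : (1 - t) * L i j <= t * a.
      by apply: le_trans (ltW small); rewrite ler_piMl // gerBl ltW.
    have H2 : t * K i j <= t * B.
      have /andP[_ KB] := loads_bound i j lK.
      by rewrite ler_pM2l // (le_trans KB) // lerDl.
    by rewrite !mxE mulrDr lerD.
  - by rewrite lef_pV2 ?posrE.
have [_ /(_ _ _ x0 xy ye) /=] := eP (i, j).
rewrite -(fineK (ufin i j)) -(fineK (cfin i j)) -EFinD lee_fin.
rewrite -(ler_pM2l (z0 i j)); apply: le_trans.
rewrite mulrDr lerD2l -mulrBl LK -mulr_sumr.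
rewrite [leRHS](_ : _ = t * (M * (K i j - L i j))); last first.
  by field; rewrite gt_eqF.
rewrite ler_pM2l //.
apply: (@le_trans _ _ (M * (a / 2))); last exact: ler_wpM2l.
by rewrite [leRHS](_ : _ = \sum_p C p) // /M; field; rewrite gt_eqF.
Qed.

(** * The objective as a jointly continuous real function *)

(** Putting the argument 0 at inactive coordinates, where all loads vanish, makes those utilities
    constants; continuity of [u] at 0 is never at stake. *)
Definition active_objective z L : R :=
  \sum_(p : 'I_n * 'I_J) z p.1 p.2 *
    fine (u p.1 p.2 (if active p.1 p.2 then L p.1 p.2 / z p.1 p.2 else 0)).

Lemma objective_active z L : pos_mx z -> loads N L ->
  (forall i j, active i j -> 0 < L i j) ->
  (forall i j, ~~ active i j -> u i j 0 \is a fin_num) ->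
  objective u z L = (active_objective z L)%:E.
Proof.
move=> z0 lL Lpos u0.
have ifE i j : L i j / z i j = if active i j then L i j / z i j else 0.
  by case: ifPn => // /(inactive0 lL) ->; rewrite mul0r.
rewrite objective_EFin => [|i j].
  by congr _%:E; apply: eq_bigr => p _; rewrite [in LHS]ifE.
rewrite ifE; case: ifPn => [ij|]; last exact: u0.
by apply: utility_fin => //; rewrite divr_gt0 ?Lpos.
Qed.

(** All loads vanish at inactive coordinates, so one load with objective above -oo settles
    finiteness there for every [z]. *)
Lemma objective_inactive z L : pos_mx z -> loads N L ->
  (-oo < objective u z L)%E ->
  forall i j, ~~ active i j -> u i j 0 \is a fin_num.
Proof.
move=> z0 lL objL i j ij.
have := objective_gtNy z0 _ objL i j; rewrite (inactive0 lL ij) mul0r; apply.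
by move=> k l; case: lL.
Qed.

(** An arbitrary filter lets [z] stay fixed, [L] stay fixed, or both vary. *)
Lemma cvg_active_objective (T : Type) (F : set_system T) (FF : Filter F)
    (f g : T -> 'M[R]_(n, J)) z L :
  pos_mx z -> (forall i j, active i j -> 0 < L i j) ->
  f @ F --> z -> g @ F --> L ->
  active_objective (f x) (g x) @[x --> F] --> active_objective z L.
Proof.
move=> z0 Lpos fz gL; rewrite /active_objective.
apply: cvg_big => [|[i j] _ /=]; first exact: add_continuous.
apply: cvgM; first exact: cvg_mx_coord.
case: ifPn => [ij|_]; last exact: cvg_cst.
apply: (@cvg_comp _ _ _ (fun x => g x i j / f x i j) (fine \o u i j) _
  (nbhs (L i j / z i j))).
  apply: cvgM; first exact: cvg_mx_coord.
  by apply: cvgV; [rewrite gt_eqF|exact: cvg_mx_coord].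
by apply: utility_continuous => //; rewrite divr_gt0 ?Lpos.
Qed.

Lemma near_pos_mx z : pos_mx z -> exists zlo zhi : R,
  [/\ 0 < zlo, zlo <= zhi
    & \forall z' \near z, forall i j, zlo <= (z' : 'M[R]_(n, J)) i j <= zhi].
Proof.
move=> z0; have [a a0 az] : exists2 a, 0 < a &
    forall p : 'I_n * 'I_J, true -> a <= z p.1 p.2.
  by apply: finite_pos_lower => p _.
pose b := a + \sum_(p : 'I_n * 'I_J) z p.1 p.2.
have zb i j : z i j < b.
  rewrite ltr_pwDl // (bigD1 (i, j)) //= lerDl sumr_ge0 // => p _.
  exact/ltW.
exists (a / 2), b; split; first exact: divr_gt0.
  have : 0 <= \sum_(p : 'I_n * 'I_J) z p.1 p.2.
    by rewrite sumr_ge0 // => p _; exact/ltW.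
  by rewrite /b; lra.
pose W i j := [set z' : 'M[R]_(n, J) | a / 2 <= z' i j <= b].
suff Wz i j : nbhs z (W i j).
  have Wz1 i : nbhs z [set z' | forall j, W i j z'].
    exact: (filter_forall (nbhs_filter z) (Wz i)).
  exact: (filter_forall (nbhs_filter z) Wz1).
have zij : (fun z' : 'M[R]_(n, J) => z' i j) @ z --> z i j.
  exact: coord_continuous.
have zF : Filter (nbhs z) := nbhs_filter z.
have az2 : a / 2 < z i j by have := az (i, j) isT => /=; lra.
have lo := @cvgr_ge _ _ _ zF _ _ zij _ az2.
have hi := @cvgr_le _ _ _ zF _ _ zij _ (zb i j).
have W_lo_hi z' : a / 2 <= z' i j -> z' i j <= b -> W i j z'.
  by rewrite /W /= => -> ->.
exact: (filterS2 zF W_lo_hi lo hi).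
Qed.

Lemma compact_active_ge d :
  compact [set L | loads N L /\ forall i j, active i j -> d <= L i j].
Proof.
rewrite (_ : mkset _ = loads N `&`
    [set L : 'M[R]_(n, J) | forall i j, active i j -> 0 <= - d + 1 * L i j]).
  apply: compact_closedI; first exact: compact_loads.
  do 3 (apply: closed_forall => ?); apply: closed_preimage_ge0.
  exact: (continuous_affine (@continuous_coord R n J _ _)).
by apply/seteqP; split=> L [lL LM]; split=> // i j ij;
  have := LM i j ij; rewrite mul1r addrC subr_ge0.
Qed.

(** * Existence and uniqueness of optima *)

Lemma optimal_exists z L0 : pos_mx z -> feasible N z L0 ->
  (-oo < objective u z L0)%E -> exists L, optimal N u z L.
Proof.
move=> z0 /feasibleP[lL0 _] objL0.
have [zlo [zhi [zlo0 zlohi /nbhs_singleton zb]]] := near_pos_mx z0.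
have [d d0 dom] := feasible_dominated zlo0 zlohi.
(* A maximizer over this compact set is optimal, since every feasible load is dominated by a member
   of it. *)
pose D := [set L | loads N L /\ forall i j, active i j -> d <= L i j] `&`
  [set L : 'M[R]_(n, J) | forall i j, 0 <= z i j * cmax N j + -1 * L i j].
have DE L : D L <-> feasible N z L /\ forall i j, active i j -> d <= L i j.
  split=> [[[lL Ld] Lz]|[/feasibleP[lL Lz] Ld]].
    split=> //; apply/feasibleP; split=> // i j.
    by rewrite -subr_ge0 -mulN1r Lz.
  by split=> // i j; rewrite mulN1r subr_ge0 Lz.
have cD : compact D.
  apply: compact_closedI; first exact: compact_active_ge.
  do 2 (apply: closed_forall => ?); apply: closed_preimage_ge0.
  exact: (continuous_affine (@continuous_coord R n J _ _)).
have D0 : D !=set0.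
  have f0 : feasible N z 0.
    apply/feasibleP; split=> [|i j]; first exact: loads0.
    by rewrite mxE mulr_ge0 ?ltW ?cmax_gt0.
  by have [L [fL Ld _]] := dom z zb 0 f0; exists L; apply/DE.
have Dpos L : D L -> forall i j, active i j -> 0 < L i j.
  by move=> /DE[_ Ld] i j ij; rewrite (lt_le_trans d0) // Ld.
have cG : {within D, continuous (active_objective z)}.
  apply/subspace_continuousP => L DL.
  apply: (cvg_within_filter (G := nbhs (active_objective z L))).
  apply: (@cvg_active_objective _ _ (nbhs_filter L) (fun=> z) id z L z0
    (Dpos L DL)).
    exact: cst_continuous.
  exact: cvg_id.
have [L /set_mem DL Lmax] := compact_EVT_max D0 cD cG.
have u0 := objective_inactive z0 lL0 objL0.
have DobjE K : D K -> objective u z K = (active_objective z K)%:E.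
  by move=> DK; apply: objective_active => //; [case: DK => -[]|exact: Dpos].
exists L; split=> [|K fK]; first by case/DE: DL.
have [K' [fK' K'd KK']] := dom z zb K fK.
have DK' : D K' by apply/DE.
by rewrite (le_trans KK') // !DobjE // lee_fin Lmax ?inE.
Qed.

(** Midpoint argument: the midpoint is feasible, no worse than average in any coordinate and
    strictly better where the two optima differ. Finite objectives allow the comparison in [R]. *)
Lemma optimal_unique z L1 L2 : pos_mx z ->
  (forall i j, strictly_concave_on_nneg (u i j)) ->
  (-oo < objective u z L1)%E -> optimal N u z L1 -> optimal N u z L2 -> L1 = L2.
Proof.
move=> z0 sconc obj1 [f1 max1] [f2 max2]; apply: contrapT => neqL.
have [i0 [j0 neqij]] : exists i j, L1 i j != L2 i j.
  apply: contrapT => neq; apply: neqL; apply/matrixP => i j; apply/eqP.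
  by apply: contrapT => /negP neqij; apply: neq; exists i, j.
have eq12 : objective u z L1 = objective u z L2.
  by apply/eqP; rewrite eq_le max2 // max1.
have obj2 : (-oo < objective u z L2)%E by rewrite -eq12.
have [lL1 Lz1] := (feasibleP N z L1).1 f1.
have [lL2 Lz2] := (feasibleP N z L2).1 f2.
have L1_ge0 i j : 0 <= L1 i j by have /andP[] := loads_bound i j lL1.
have L2_ge0 i j : 0 <= L2 i j by have /andP[] := loads_bound i j lL2.
have fin1 := objective_gtNy z0 L1_ge0 obj1.
have fin2 := objective_gtNy z0 L2_ge0 obj2.
have x1 i j : 0 <= L1 i j / z i j by rewrite divr_ge0 // ltW.
have x2 i j : 0 <= L2 i j / z i j by rewrite divr_ge0 // ltW.
pose K := (1 - 2^-1) *: L1 + 2^-1 *: L2.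
have KE i j : K i j / z i j =
    2^-1 * (L1 i j / z i j) + (1 - 2^-1) * (L2 i j / z i j).
  by rewrite !mxE; field; rewrite gt_eqF.
have x0 i j : 0 <= K i j / z i j.
  by rewrite KE addr_ge0 // mulr_ge0 //; lra.
have fK : feasible N z K.
  apply/feasibleP; split.
    by apply: loads_comb => //; apply/andP; split; lra.
  by move=> i j; rewrite !mxE; have := Lz1 i j; have := Lz2 i j; lra.
have avg (a b : R) (x : \bar R) : (x < +oo)%E ->
    (2^-1%:E * a%:E + (1 - 2^-1)%:E * b%:E <= x)%E ->
    x \is a fin_num /\ 2^-1 * (a + b) <= fine x.
  case: x => [x _| |_]; rewrite ?ltxx // -!EFinM -EFinD ?leeNy_eq // lee_fin.
  by move=> abx; split=> //=; lra.
have half01 : 0 <= (2^-1 : R) <= 1 by apply/andP; split; lra.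
have mid i j : u i j (K i j / z i j) \is a fin_num /\
    2^-1 * (fine (u i j (L1 i j / z i j)) + fine (u i j (L2 i j / z i j))) <=
    fine (u i j (K i j / z i j)).
  apply: avg; first exact: utility_lty.
  by rewrite !fineK // KE; apply: (utility_concave (u_utility i j)).
have fin0 i j : u i j (K i j / z i j) \is a fin_num by case: (mid i j).
have strict : 2^-1 * (fine (u i0 j0 (L1 i0 j0 / z i0 j0)) +
    fine (u i0 j0 (L2 i0 j0 / z i0 j0))) < fine (u i0 j0 (K i0 j0 / z i0 j0)).
  have neqx : L1 i0 j0 / z i0 j0 != L2 i0 j0 / z i0 j0.
    by rewrite (inj_eq (mulIf _)) // invr_neq0 // gt_eqF.
  have := @sconc i0 j0 _ _ 2^-1 (x1 i0 j0) (x2 i0 j0).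
  rewrite -KE -(fineK (fin1 i0 j0)) -(fineK (fin2 i0 j0)) -(fineK (fin0 i0 j0)).
  rewrite -!EFinM -EFinD lte_fin /=.
  rewrite neqx => /(_ isT).
  have -> : 0 < (2^-1 : R) < 1 by apply/andP; split; lra.
  by move=> /(_ isT); lra.
have := max1 K fK; have := max2 K fK; rewrite !objective_EFin // !lee_fin.
set S0 := \sum_p _; set S1 := \sum_p _; set S2 := \sum_p _ => K1 K2.
(* This sum is the objective of [K] minus the mean of the two optimal ones, which optimality makes
   at most 0. *)
suff : 0 < \sum_(p : 'I_n * 'I_J)
    z p.1 p.2 * (fine (u p.1 p.2 (K p.1 p.2 / z p.1 p.2))
    - 2^-1 * (fine (u p.1 p.2 (L1 p.1 p.2 / z p.1 p.2))
    + fine (u p.1 p.2 (L2 p.1 p.2 / z p.1 p.2)))).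
  under eq_bigr do rewrite mulrBr mulrCA mulrDr mulrDr.
  by rewrite sumrB big_split /= -!mulr_sumr -/S0 -/S1 -/S2; lra.
rewrite (bigD1 (i0, j0)) //= ltr_wpDr //.
  apply: sumr_ge0 => p _; apply: mulr_ge0; first exact/ltW/z0.
  by rewrite subr_ge0; case: (mid p.1 p.2).
by rewrite mulr_gt0 // subr_gt0.
Qed.

(** * Continuity of the optimal load *)

(** The load that dominates the optimum is itself optimal, hence equal to it by uniqueness. *)
Lemma optimal_positive z d Lz : pos_mx z ->
  dominated d z -> unique (optimal N u z) Lz ->
  forall i j, active i j -> d <= Lz i j.
Proof.
move=> z0 dom [[fLz maxLz] uniq]; have [L' [fL' L'd leL']] := dom Lz fLz.
suff -> : Lz = L' by [].
by apply: uniq; split=> // L fL; rewrite (le_trans (maxLz L fL)).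
Qed.

(* For x positive on the active coordinates and different from the optimum at
   z0, x cannot be near the optimum at z when z is near z0: either x violates a
   strict bound at z0, or some L beats x strictly at z0, and then s *: L with
   s < 1 close to 1 is feasible at z and still beats everything near x. *)
Lemma optimal_separation (Lam : 'M[R]_(n, J) -> 'M[R]_(n, J)) d zlo zhi z0 x :
  (forall z, pos_mx z -> unique (optimal N u z) (Lam z)) ->
  0 < d ->
  (forall z, (forall i j, zlo <= z i j <= zhi) -> dominated d z) ->
  pos_mx z0 ->
  (\forall z \near z0, forall i j, zlo <= (z : 'M[R]_(n, J)) i j <= zhi) ->
  loads N x -> (forall i j, active i j -> d <= x i j) -> Lam z0 <> x ->
  filter_prod (nbhs x) (within (@pos_mx R n J) (nbhs z0))
    [set q | Lam q.2 <> q.1].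
Proof.
move=> opt d0 dom z00 zb lx xd neqx.
pose F := filter_prod (nbhs x) (within (@pos_mx R n J) (nbhs z0)).
have Fx : Filter (nbhs x) := nbhs_filter x.
have Fz : Filter (nbhs z0) := nbhs_filter z0.
have Fw : Filter (within (@pos_mx R n J) (nbhs z0)) := within_filter _ Fz.
have FF : Filter F by exact: filter_prod_filter.
have cv1 : fst @ F --> x by exact: cvg_fst.
have cvw : snd @ F --> within (@pos_mx R n J) (nbhs z0) by exact: cvg_snd.
have cv2 : snd @ F --> z0 by apply: cvg_trans cvw _; exact: cvg_within.
have Fpos : F [set q | pos_mx q.2] by apply: cvw; exact: withinT.
have cvG (f : _ -> 'M[R]_(n, J)) L : f @ F --> L ->
    (forall i j, active i j -> 0 < L i j) ->
    active_objective q.2 (f q) @[q --> F] --> active_objective z0 L.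
  by move=> fL Lpos; exact: cvg_active_objective.
(* A strict violation of the bound persists for nearby loads and nearby [z], while [Lam z] is
   feasible. *)
have [[i [j xij]]|inbox] := pselect (exists i j, z0 i j * cmax N j < x i j).
  pose g (q : 'M[R]_(n, J) * 'M[R]_(n, J)) := q.1 i j - q.2 i j * cmax N j.
  have cg : g @ F --> x i j - z0 i j * cmax N j.
    apply: cvgB; first exact: cvg_mx_coord.
    by apply: cvgM; [exact: cvg_mx_coord|exact: cvg_cst].
  have gF : F [set q | 0 < g q] by apply: (cvgr_gt _ cg); rewrite subr_gt0.
  apply: filterS2 gF Fpos => -[L z] /= gq zpos LamL.
  have [[/feasibleP[_ /(_ i j)] + _] _] := opt z zpos.
  by rewrite LamL leNgt -subr_gt0 gq.
have fx : feasible N z0 x.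
  apply/feasibleP; split=> // i j; rewrite leNgt; apply/negP => xij.
  by apply: inbox; exists i, j.
have zb0 := nbhs_singleton zb.
have [L [fL Ld xL]] : exists L, [/\ feasible N z0 L,
    forall i j, active i j -> d <= L i j
    & (objective u z0 x < objective u z0 L)%E].
  have [L1 fL1 xL1] : exists2 L, feasible N z0 L &
      (objective u z0 x < objective u z0 L)%E.
    apply: contrapT => nex; apply: neqx; apply: (opt z0 z00).2; split=> // L fL.
    by rewrite leNgt; apply/negP => xL; apply: nex; exists L.
  have [L [fL Ld L1L]] := dom z0 zb0 L1 fL1.
  by exists L; split=> //; exact: lt_le_trans L1L.
have [lL Lz] := (feasibleP N z0 L).1 fL.
have pos_of (K : 'M[R]_(n, J)) : (forall i j, active i j -> d <= K i j) ->
    forall i j, active i j -> 0 < K i j.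
  by move=> Kd i j ij; exact: lt_le_trans d0 (Kd i j ij).
have u0 := objective_inactive z00 lL (le_lt_trans (leNye _) xL).
move: xL; rewrite !objective_active // ?lte_fin; try exact: pos_of.
set gx := active_objective z0 x; set gL := active_objective z0 L => xL.
(* A separating level: near [(x, z0)] the objective stays below [m], while that of [s *: L] stays
   above it. *)
pose m := (gx + gL) / 2.
have gxm : gx < m by rewrite /m; lra.
have mgL : m < gL by rewrite /m; lra.
have [s [s0 s1 ms]] : exists s,
    [/\ 0 < s, s < 1 & m < active_objective z0 (s *: L)].
  have cs : active_objective z0 (s *: L) @[s --> (1 : R)^'-] --> gL.
    apply: cvg_active_objective => //; [exact: pos_of|exact: cvg_cst|].
    apply: cvg_at_left_filter; rewrite -[X in _ --> X]scale1r.
    exact: scalel_continuous.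
  have ms : \forall s \near (1 : R)^'-, m < active_objective z0 (s *: L).
    exact: (cvgr_gt _ cs).
  have [s [[s0 s1] ms']] := filter_ex
    (filterI (filterI (nbhs_left_gt (ltr01 : 0 < 1 :> R))
                      (nbhs_left_lt (1 : R))) ms).
  by exists s.
(* Since [s < 1], each [z] near [z0] satisfies [s * z0 <= z] entrywise, which makes [s *: L]
   feasible at [z]. *)
pose W i j := [set q : 'M[R]_(n, J) * 'M[R]_(n, J) | s * z0 i j <= q.2 i j].
have FW i j : F (W i j).
  have cij : (fun q : 'M[R]_(n, J) * 'M[R]_(n, J) => q.2 i j) @ F --> z0 i j.
    exact: cvg_mx_coord.
  by apply: (cvgr_ge _ cij); rewrite gtr_pMl // z00.
have sz : F [set q | forall i j, W i j q].
  exact: (filter_forall FF (fun i => filter_forall FF (FW i))).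
have sLpos i j : active i j -> 0 < (s *: L) i j.
  by move=> ij; rewrite mxE mulr_gt0 // (pos_of L).
have Gs : F [set q | m < active_objective q.2 (s *: L)].
  by apply: (cvgr_gt _ (cvG _ _ (cvg_cst _) sLpos)).
have Gx : F [set q | active_objective q.2 q.1 < m].
  by apply: (cvgr_lt _ (cvG _ _ cv1 (pos_of x xd))).
have Fzb : F [set q : 'M[R]_(n, J) * 'M[R]_(n, J) |
    forall i j, zlo <= q.2 i j <= zhi] by exact: (cv2 _ zb).
apply: filterS2 (filterI (filterI Gs Gx) sz) (filterI Fpos Fzb) => -[K z] /=.
move=> [[mG Gm] szz] [zpos zbz] LamK.
have Kd : forall i j, active i j -> d <= K i j.
  by rewrite -LamK; apply: optimal_positive zpos (dom z zbz) (opt z zpos).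
have [[fK maxK] _] := opt z zpos; rewrite LamK in fK maxK.
have lsL : loads N (s *: L).
  have := @loads_comb _ _ _ N s 0 L; rewrite scaler0 add0r; apply=> //.
    by rewrite !ltW.
  exact: loads0.
have fsL : feasible N z (s *: L).
  apply/feasibleP; split=> // i j; rewrite mxE.
  rewrite (le_trans (ler_wpM2l (ltW s0) (Lz i j))) // mulrA.
  exact: (ler_wpM2r (ltW (cmax_gt0 N j)) (szz i j)).
have [lK _] := (feasibleP N z K).1 fK.
have := maxK _ fsL; rewrite !objective_active // ?lee_fin; last exact: pos_of.
by rewrite leNgt (lt_trans Gm mG).
Qed.

(** Each load in the compact set [D] is either [Lam z0], which lies in [V], or is separated from
    [Lam z] for [z] near [z0]. Compactness gives one neighbourhood of [z0] for all of [D]; there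
    [Lam z] lies in [D], hence in [V]. *)
Lemma optimal_continuous (Lam : 'M[R]_(n, J) -> 'M[R]_(n, J)) :
  (forall z, pos_mx z -> unique (optimal N u z) (Lam z)) ->
  {within @pos_mx R n J, continuous Lam}.
Proof.
move=> opt; apply/subspace_continuousP => z0 z00 V /= LV.
have [zlo [zhi [zlo0 zlohi zb]]] := near_pos_mx z00.
have [d d0 dom] := feasible_dominated zlo0 zlohi.
have Fz : Filter (nbhs z0) := nbhs_filter z0.
have Fw : Filter (within (@pos_mx R n J) (nbhs z0)) := within_filter _ Fz.
pose D := [set L | loads N L /\ forall i j, active i j -> d <= L i j].
have covD : within (@pos_mx R n J) (nbhs z0)
    [set z : 'M[R]_(n, J) | D `<=` (fun L => Lam z = L -> V L)].
  apply: ((compact_near_coveringP D).1 (@compact_active_ge d) _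
    (within (@pos_mx R n J) (nbhs z0)) (fun z L => Lam z = L -> V L) Fw).
  move=> x [lx xd]; have [<-|neqx] := pselect (Lam z0 = x).
    exists (V, setT); first by split=> //; exact: filterT.
    by move=> [L z] /= [VL _] _.
  apply: filterS (optimal_separation opt d0 dom z00 zb lx xd neqx) => -[L z] /=.
  by move=> neq /neq.
have Fpos : within (@pos_mx R n J) (nbhs z0) (@pos_mx R n J) by exact: withinT.
have zbw : within (@pos_mx R n J) (nbhs z0)
    [set z | forall i j, zlo <= (z : 'M[R]_(n, J)) i j <= zhi].
  exact: cvg_within zb.
have VLam z : (D `<=` (fun L => Lam z = L -> V L)) -> pos_mx z ->
    (forall i j, zlo <= z i j <= zhi) -> V (Lam z).
  move=> covz zpos zbz; apply: (covz (Lam z)) => //.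
  split; first by have [[/feasibleP[]]] := opt z zpos.
  exact: optimal_positive zpos (dom z zbz) (opt z zpos).
exact: (filterS3 Fw VLam covD Fpos zbw).
Qed.

End Optimum.

(** The first part gives conditions under which the premise on [Lam] in the second can be met. *)
Theorem theorem3p2 (R : realType) (n J : nat) (N : network R n J)
    (u : 'I_n -> 'I_J -> R -> \bar R)
    (u_utility : forall i j, utility (u i j))
    (N_ratio : same_ratio N) :
  ((forall i j, strictly_concave_on_nneg (u i j)) ->
   forall z : 'M[R]_(n, J), pos_mx z ->
     (exists L0, feasible N z L0 /\ (-oo < objective u z L0)%E) ->
     exists! L, optimal N u z L) /\
  (forall Lam : 'M[R]_(n, J) -> 'M[R]_(n, J),
     (forall z, pos_mx z -> unique (optimal N u z) (Lam z)) ->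
     {within @pos_mx R n J, continuous Lam}).
Proof.
split=> [sconc z z0 [L0 [fL0 objL0]]|]; last exact: optimal_continuous.
have [L optL] := optimal_exists u_utility z0 fL0 objL0.
exists L; split=> // L' optL'.
apply: (optimal_unique u_utility z0 sconc _ optL optL').
by case: optL => _ maxL; exact: lt_le_trans objL0 (maxL L0 fL0).
Qed.
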